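(* Let $A, B, L$ be real numbers with $A < B$ and $L > B-A$. Then the equation $$\sinh \xi - \frac{L}{B-A}\, \xi = 0$$ has exactly one positive solution $\xi$, and consequently the equation $$\sinh\left(\frac{B-A}{2\lambda}\right) = \frac{L}{2\lambda}$$ has exactly one positive solution $\lambda$ (the two equations being related by $\xi = \frac{B-A}{2\lambda}$). Moreover, Newton's method applied to the equation $\sinh \xi - \frac{L}{B-A}\,\xi = 0$ with initial guess $\sqrt{6\,\frac{L}{B-A}}$ converges to the positive solution $\xi$.
   Context: Newton's method applied to an equation $f(\xi)=0$ with initial guess $\xi_0$ is the iteration $\xi_{n+1} = \xi_n - f(\xi_n)/f'(\xi_n)$, $n \geq 0$; here $f(\xi) = \sinh \xi - \frac{L}{B-A}\,\xi$. (Background: $L$ is the length of an inelastic cable attached at two points at equal height with horizontal coordinates $A$ and $B$, and $\lambda$ is the shape parameter of the resulting catenary.) *)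

(* Defs.v *)
From Stdlib Require Import Reals.
From Coquelicot Require Import Coquelicot.
Open Scope R_scope.

Definition newton_step (f : R -> R) (x : R) : R := x - f x / Derive f x.

Fixpoint newton (f : R -> R) (x0 : R) (n : nat) : R :=
  match n with
  | O => x0
  | S m => newton_step f (newton f x0 m)
  end.

(* [Derive] and [/] are total functions in Coquelicot and Stdlib, so that the
   iteration is meaningful (f differentiable with nonzero derivative at every
   iterate) has to be required explicitly. *)
Definition newton_converges (f : R -> R) (x0 x : R) : Prop :=
  (forall n : nat, ex_derive f (newton f x0 n) /\ Derive f (newton f x0 n) <> 0)
  /\ is_lim_seq (newton f x0) x.

Definition cable_fun (A B L : R) (xi : R) : R := sinh xi - L / (B - A) * xi.

(* Main.v *)
Require Import Defs.
From Stdlib Require Import Reals Lra.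
From Coquelicot Require Import Coquelicot.
Open Scope R_scope.

(** Put [K = L / (B - A) > 1] and [f x = sinh x - K x], so that
    [f' x = cosh x - K] increases on [0, +oo).  Since [f 0 = 0], the mean value
    theorem gives [f x < 0] at every [x > 0] with [cosh x <= K]; hence a point
    [x > 0] with [f x >= 0] has [f' x > 0], and [f] is strictly increasing from
    there on ([cable_increasing]).  So there is at most one positive root.  The
    root exists by the intermediate value theorem between [ln K], where
    [cosh (ln K) = (K + / K) / 2 < K], and the initial guess [sqrt (6 K)], where
    [sinh x >= x + x ^ 3 / 6] gives [f x >= x > 0].

    In particular the initial guess lies to the right of the root [xi].  There
    the function is convex with positive derivative, so Newton's iterates
    decrease, stay at or above [xi], and converge to it: each step reduces the
    error at least by the factor [1 - f' xi / f' x0 < 1]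
    ([newton_converges_convex]). *)

(** * Newton's method to the right of a root of a convex function *)

(** With [f xi = 0] and [f y = f' c * (y - xi)] for some [c] in [(xi, y)],
    monotonicity of [f'] encloses [f y / (y - xi)] between [f' xi] and [f' y]. *)
Lemma newton_step_convex (f f' : R -> R) (xi x0 y : R) :
  (forall x, is_derive f x (f' x)) ->
  (forall x z, xi <= x <= z -> f' x <= f' z) ->
  0 < f' xi -> f xi = 0 -> xi <= y <= x0 ->
  0 <= newton_step f y - xi <= (1 - f' xi / f' x0) * (y - xi).
Proof.
intros Hd Hmono Hpos Hroot [Hy Hyx0].
unfold newton_step.
rewrite (is_derive_unique _ _ _ (Hd y)).
assert (Hfy : f' xi <= f' y) by (apply Hmono; lra).
assert (Hf0 : f' y <= f' x0) by (apply Hmono; lra).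
assert (Hbounds : f' xi * (y - xi) <= f y <= f' y * (y - xi)).
{ destruct Hy as [Hlt | <-]; [ | rewrite Hroot; lra].
  destruct (MVT_cor2 f f' xi y Hlt) as [c [Hc Hcb]].
  { intros c _; apply is_derive_Reals, Hd. }
  rewrite Hroot, Rminus_0_r in Hc; rewrite Hc.
  split; apply Rmult_le_compat_r; try lra; apply Hmono; lra. }
assert (Hupper : f y / f' y <= y - xi).
{ apply Rle_div_l; lra. }
assert (Hlower : f' xi / f' x0 * (y - xi) <= f y / f' y).
{ apply Rle_trans with (f' xi * (y - xi) / f' y).
  - replace (f' xi / f' x0 * (y - xi)) with (f' xi * (y - xi) * / f' x0)
      by (field; lra).
    apply Rmult_le_compat_l.
    + apply Rmult_le_pos; lra.
    + apply Rinv_le_contravar; lra.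
  - apply Rmult_le_compat_r; [ | lra].
    left; apply Rinv_0_lt_compat; lra. }
lra.
Qed.

Lemma newton_converges_convex (f f' : R -> R) (xi x0 : R) :
  (forall x, is_derive f x (f' x)) ->
  (forall x z, xi <= x <= z -> f' x <= f' z) ->
  0 < f' xi -> f xi = 0 -> xi <= x0 ->
  newton_converges f x0 xi.
Proof.
intros Hd Hmono Hpos Hroot Hx0.
assert (Hf0 : f' xi <= f' x0) by (apply Hmono; lra).
set (q := 1 - f' xi / f' x0).
assert (Hq : 0 <= q < 1).
{ assert (0 < f' xi / f' x0) by (apply Rdiv_lt_0_compat; lra).
  assert (f' xi / f' x0 <= 1) by (apply Rle_div_l; lra).
  unfold q; lra. }
assert (Hin : forall n, xi <= newton f x0 n <= x0 /\
                        newton f x0 n - xi <= (x0 - xi) * q ^ n).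
{ induction n as [ | n [IHb IHq]]; simpl; [lra | ].
  pose proof (newton_step_convex f f' xi x0 _ Hd Hmono Hpos Hroot IHb) as Hs.
  fold q in Hs.
  set (y := newton f x0 n) in *.
  assert (q * (y - xi) <= 1 * (y - xi)) by (apply Rmult_le_compat_r; lra).
  assert (q * (y - xi) <= q * ((x0 - xi) * q ^ n))
    by (apply Rmult_le_compat_l; lra).
  lra. }
split.
- intros n; destruct (Hin n) as [Hb _]; split.
  + eexists; apply Hd.
  + rewrite (is_derive_unique _ _ _ (Hd _)).
    assert (f' xi <= f' (newton f x0 n)) by (apply Hmono; lra).
    lra.
- apply is_lim_seq_le_le with (fun _ => xi) (fun n => xi + (x0 - xi) * q ^ n).
  + intros n; destruct (Hin n); lra.
  + apply is_lim_seq_const.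
  + replace (Finite xi) with (Finite (xi + (x0 - xi) * 0)) by (f_equal; ring).
    apply (is_lim_seq_plus' (fun _ => xi) (fun n => (x0 - xi) * q ^ n)).
    * apply is_lim_seq_const.
    * apply (is_lim_seq_scal_l (fun n => q ^ n) (x0 - xi) 0).
      apply is_lim_seq_geom; rewrite Rabs_pos_eq; lra.
Qed.

(** * Hyperbolic sine and cosine on the positive half-line *)

Lemma cosh_lt (x y : R) : 0 <= x -> x < y -> cosh x < cosh y.
Proof.
intros Hx Hxy.
destruct (MVT_cor2 cosh sinh x y Hxy) as [c [Hc Hcb]].
{ intros c _; apply derivable_pt_lim_cosh. }
assert (0 < sinh c) by (rewrite <- sinh_0; apply sinh_lt; lra).
assert (0 < sinh c * (y - x)) by (apply Rmult_lt_0_compat; lra).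
lra.
Qed.

Lemma cosh_le (x y : R) : 0 <= x -> x <= y -> cosh x <= cosh y.
Proof.
intros Hx [Hxy | <-]; [ | lra].
left; apply cosh_lt; lra.
Qed.

Lemma nonneg_of_derivative (h h' : R -> R) (x : R) :
  (forall y, is_derive h y (h' y)) -> h 0 = 0 ->
  (forall y, 0 <= y -> 0 <= h' y) -> 0 <= x -> 0 <= h x.
Proof.
intros Hd H0 Hpos [Hx | <-]; [ | lra].
destruct (MVT_cor2 h h' 0 x Hx) as [c [Hc Hcb]].
{ intros c _; apply is_derive_Reals, Hd. }
assert (0 <= h' c * (x - 0)) by (apply Rmult_le_pos; [apply Hpos | ]; lra).
lra.
Qed.

Lemma is_derive_sinh (x : R) : is_derive sinh x (cosh x).
Proof. apply is_derive_Reals, derivable_pt_lim_sinh. Qed.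

Lemma is_derive_cosh (x : R) : is_derive cosh x (sinh x).
Proof. apply is_derive_Reals, derivable_pt_lim_cosh. Qed.

(** Obtained from [cosh >= 1] by integrating three times from [0]. *)
Lemma sinh_ge_cubic (x : R) : 0 <= x -> x + x ^ 3 / 6 <= sinh x.
Proof.
intros Hx.
assert (H1 : forall y, 0 <= y -> 0 <= sinh y - y).
{ intros y; apply (nonneg_of_derivative (fun y => sinh y - y)
                             (fun y => cosh y - 1)).
  - intros z; apply (is_derive_minus sinh (fun y => y)).
    + apply is_derive_sinh.
    + apply (is_derive_id (K := R_AbsRing)).
  - rewrite sinh_0; ring.
  - intros z Hz; rewrite <- cosh_0; generalize (cosh_le 0 z (Rle_refl 0) Hz); lra. }
assert (H2 : forall y, 0 <= y -> 0 <= cosh y - (1 + y ^ 2 / 2)).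
{ intros y; apply (nonneg_of_derivative (fun y => cosh y - (1 + y ^ 2 / 2))
                             (fun y => sinh y - y)).
  - intros z; apply (is_derive_minus cosh (fun y => 1 + y ^ 2 / 2)).
    + apply is_derive_cosh.
    + auto_derive; [easy | field].
  - rewrite cosh_0; field.
  - exact H1. }
assert (H3 : 0 <= sinh x - (x + x ^ 3 / 6)).
{ revert Hx.
  apply (nonneg_of_derivative (fun x => sinh x - (x + x ^ 3 / 6))
           (fun y => cosh y - (1 + y ^ 2 / 2))).
  - intros z; apply (is_derive_minus sinh (fun y => y + y ^ 3 / 6)).
    + apply is_derive_sinh.
    + auto_derive; [easy | field].
  - rewrite sinh_0; field.
  - exact H2. }
lra.
Qed.

(** * The catenary equation *)

Lemma is_derive_cable_fun (A B L x : R) :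
  is_derive (cable_fun A B L) x (cosh x - L / (B - A)).
Proof.
apply (is_derive_minus sinh (fun y => L / (B - A) * y)).
- apply is_derive_sinh.
- auto_derive; [easy | ring].
Qed.

Lemma cable_fun_0 (A B L : R) : cable_fun A B L 0 = 0.
Proof. unfold cable_fun; rewrite sinh_0; ring. Qed.

(** The derivative is negative on [(0, x)], as [cosh] is strictly increasing. *)
Lemma cable_neg (A B L x : R) :
  0 < x -> cosh x <= L / (B - A) -> cable_fun A B L x < 0.
Proof.
set (K := L / (B - A)).
intros Hx HK.
destruct (MVT_cor2 (cable_fun A B L) (fun y => cosh y - K) 0 x Hx)
  as [c [Hc Hcb]].
{ intros c _; apply is_derive_Reals, is_derive_cable_fun. }
rewrite cable_fun_0 in Hc.
assert (cosh c < cosh x) by (apply cosh_lt; lra).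
assert (0 < (K - cosh c) * (x - 0)) by (apply Rmult_lt_0_compat; lra).
lra.
Qed.

Lemma cable_derive_pos (A B L x : R) :
  0 < x -> 0 <= cable_fun A B L x -> 0 < cosh x - L / (B - A).
Proof.
set (K := L / (B - A)).
intros Hx Hf.
destruct (Rle_or_lt (cosh x) K) as [HK | HK]; [ | lra].
generalize (cable_neg A B L x Hx HK); lra.
Qed.

Lemma cable_increasing (A B L x y : R) :
  0 < x -> x < y -> 0 <= cable_fun A B L x ->
  cable_fun A B L x < cable_fun A B L y.
Proof.
set (K := L / (B - A)).
intros Hx Hxy Hf.
destruct (MVT_cor2 (cable_fun A B L) (fun y => cosh y - K) x y Hxy)
  as [c [Hc Hcb]].
{ intros c _; apply is_derive_Reals, is_derive_cable_fun. }
pose proof (cable_derive_pos A B L x Hx Hf) as Hpos; fold K in Hpos.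
assert (cosh x < cosh c) by (apply cosh_lt; lra).
assert (0 < (cosh c - K) * (y - x)) by (apply Rmult_lt_0_compat; lra).
lra.
Qed.

Lemma cable_root_unique (A B L x y : R) :
  0 < x -> cable_fun A B L x = 0 -> 0 < y -> cable_fun A B L y = 0 -> x = y.
Proof.
intros Hx Hfx Hy Hfy.
destruct (Rtotal_order x y) as [H | [H | H]]; [ | exact H | ].
- generalize (cable_increasing A B L x y Hx H); lra.
- generalize (cable_increasing A B L y x Hy H); lra.
Qed.

Lemma cable_guess_pos (A B L : R) :
  1 < L / (B - A) ->
  0 < sqrt (6 * (L / (B - A))) /\ 0 < cable_fun A B L (sqrt (6 * (L / (B - A)))).
Proof.
set (K := L / (B - A)).
intros HK.
set (x := sqrt (6 * K)).
assert (Hx : 0 < x) by (apply sqrt_lt_R0; lra).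
assert (Hsq : x * x = 6 * K) by (apply sqrt_sqrt; lra).
split; [exact Hx | ].
pose proof (sinh_ge_cubic x (Rlt_le _ _ Hx)) as Hs.
replace (x ^ 3 / 6) with (K * x) in Hs
  by (replace (x ^ 3) with (x * x * x) by ring; rewrite Hsq; field).
unfold cable_fun; fold K; lra.
Qed.

Lemma cable_root_exists (A B L : R) :
  1 < L / (B - A) ->
  exists xi, 0 < xi /\ cable_fun A B L xi = 0.
Proof.
set (K := L / (B - A)).
intros HK.
destruct (cable_guess_pos A B L HK) as [Hx0 Hf0]; fold K in Hx0, Hf0.
assert (Hm : 0 < ln K) by (rewrite <- ln_1; apply ln_increasing; lra).
assert (Hcosh : cosh (ln K) <= K).
{ unfold cosh; rewrite exp_Ropp, exp_ln by lra.
  assert (/ K < / 1) by (apply Rinv_lt_contravar; lra).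
  lra. }
pose proof (cable_neg A B L (ln K) Hm Hcosh) as Hfm.
assert (Hlt : ln K < sqrt (6 * K)).
{ destruct (Rlt_or_le (ln K) (sqrt (6 * K))) as [H | [H | H]]; [exact H | | ].
  - generalize (cable_increasing A B L _ _ Hx0 H); lra.
  - rewrite H in Hf0; lra. }
destruct (IVT (cable_fun A B L) (ln K) (sqrt (6 * K))) as [z [Hz Hfz]]; auto.
- intros x; apply derivable_continuous_pt.
  exists (cosh x - K); apply is_derive_Reals, is_derive_cable_fun.
- exists z; split; [lra | exact Hfz].
Qed.

Lemma cable_newton (A B L xi : R) :
  1 < L / (B - A) -> 0 < xi -> cable_fun A B L xi = 0 ->
  newton_converges (cable_fun A B L) (sqrt (6 * (L / (B - A)))) xi.
Proof.
set (K := L / (B - A)).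
intros HK Hxi Hroot.
destruct (cable_guess_pos A B L HK) as [Hx0 Hf0]; fold K in Hx0, Hf0.
apply newton_converges_convex with (fun x => cosh x - K).
- intros x; apply is_derive_cable_fun.
- intros x z Hxz; generalize (cosh_le x z); lra.
- apply cable_derive_pos; lra.
- exact Hroot.
- destruct (Rle_or_lt xi (sqrt (6 * K))) as [H | H]; [exact H | ].
  generalize (cable_increasing A B L _ _ Hx0 H); lra.
Qed.

Lemma cable_fun_lambda (A B L lambda : R) :
  A < B -> 0 < lambda ->
  (cable_fun A B L ((B - A) / (2 * lambda)) = 0 <->
   sinh ((B - A) / (2 * lambda)) = L / (2 * lambda)).
Proof.
intros HAB Hl; unfold cable_fun.
replace (L / (B - A) * ((B - A) / (2 * lambda))) with (L / (2 * lambda))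
  by (field; lra).
lra.
Qed.

Theorem proposition1 (A B L : R) (hAB : A < B) (hL : B - A < L) :
  (exists! xi : R, 0 < xi /\ cable_fun A B L xi = 0) /\
  (exists! lambda : R,
     0 < lambda /\ sinh ((B - A) / (2 * lambda)) = L / (2 * lambda)) /\
  (forall xi lambda : R, 0 < lambda -> xi = (B - A) / (2 * lambda) ->
     (cable_fun A B L xi = 0 <->
      sinh ((B - A) / (2 * lambda)) = L / (2 * lambda))) /\
  (forall xi : R, 0 < xi -> cable_fun A B L xi = 0 ->
     newton_converges (cable_fun A B L) (sqrt (6 * (L / (B - A)))) xi).
Proof.
assert (HK : 1 < L / (B - A)) by (apply Rlt_div_r; lra).
destruct (cable_root_exists A B L HK) as [xi [Hxi Hroot]].
split; [ | split; [ | split]].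
- exists xi; split; [now split | ].
  intros y [Hy Hfy]; now apply (cable_root_unique A B L).
- (* The map [x |-> (B - A) / (2 x)] is its own inverse, so [lambda] is
     obtained from [xi] by the formula that gives [xi] from [lambda]. *)
  exists ((B - A) / (2 * xi)).
  assert (Hl : 0 < (B - A) / (2 * xi)) by (apply Rdiv_lt_0_compat; lra).
  split.
  + split; [exact Hl | ].
    apply cable_fun_lambda; [lra | exact Hl | ].
    replace ((B - A) / (2 * ((B - A) / (2 * xi)))) with xi by (field; lra).
    exact Hroot.
  + intros l [Hlpos Heq].
    apply cable_fun_lambda in Heq; [ | lra | exact Hlpos].
    rewrite (cable_root_unique A B L xi ((B - A) / (2 * l))); auto.
    * field; lra.
    * apply Rdiv_lt_0_compat; lra.
- intros x l Hl ->; now apply cable_fun_lambda.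
- intros x Hx Hfx; now apply cable_newton.
Qed.
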